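(* Let $k$ be a field and $C$ a $k$-coalgebra. The character map $\chi\colon G^k_0(C^* )\to C^{**}$ is compatible with the $C$-colinear trace $\chi^c$, in the sense that the composite $$G^c_0(C)\xrightarrow{\chi^c}\mathrm{coHH}_0(C)\hookrightarrow C\xrightarrow{\varepsilon_C}C^{**}$$ equals the composite $$G^c_0(C)\longrightarrow G^k_0(C^* )\xrightarrow{\chi}C^{**},$$ where $G^c_0(C)\to G^k_0(C^* )$ is induced by the comparison map sending a finite dimensional right $C$-comodule to the same vector space regarded as a left $C^*$-module, and $\varepsilon_C\colon C\hookrightarrow C^{**}$ is the evaluation map.
   Context: $C^*=\mathrm{Hom}_k(C,k)$ is a $k$-algebra with product $(f\star g)(c)=\sum_{(c)} f(c_{(1)})g(c_{(2)})$. $G^c_0(C)$ is $K_0$ of the abelian category of finite dimensional right $C$-comodules; $G^k_0(A)$ is $K_0$ of the abelian category of finite dimensional $A$-modules (left modules are used for the comparison map; left and right are identified by linear duality, which preserves characters). A right $C$-comodule $V$ with coaction $v\mapsto\sum_{(v)} v_{(0)}\otimes v_{(1)}$ is a left $C^*$-module by $f\cdot v=\sum_{(v)} f(v_{(1)})v_{(0)}$. The character of a finite dimensional $A$-module $V$ is $\chi(V)\in A^*$, $\chi(V)(a)=$ trace of the $k$-linear action of $a$ on $V$. $\mathrm{coHH}_0(C)=\ker(\Delta-\tau\Delta)\subseteq C$, with $\tau$ the swap on $C\otimes C$. The $C$-colinear trace of a finite dimensional right $C$-comodule $V$ with basis $e_1,\dots,e_n$ is $\chi^c(V)=\sum_{i=1}^n\sum_{(e_i)}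 e_i^*({e_i}_{(0)})\,{e_i}_{(1)}\in\mathrm{coHH}_0(C)\subseteq C$. The map $\varepsilon_C$ is $\varepsilon_C(c)(f)=f(c)$. *)

(* Defs.v *)
From HB Require Import structures.
From mathcomp Require Import all_boot all_order all_algebra.
From mathcomp Require Import boolp.

Set Implicit Arguments.
Unset Strict Implicit.
Unset Printing Implicit Defensive.

Import GRing.Theory.
Local Open Scope ring_scope.
Local Open Scope quotient_scope.

Notation bilin := (bilinear_for *:%R *:%R).

(* Tensor product of two k-vector spaces of any dimension.  A finite sequence of
   pairs (v, w) stands for the sum of the v (x) w; two sequences are identified
   when every bilinear map gives them the same sum.  The quotient has the
   universal property of the tensor product: pure is bilinear (pure_bilin), its
   values span (tens_pure), and a bilinear b factors through the linear map
   tsum b (tsum_linear, tsum_pure).  In Sweedler notation, tsum b t is the sum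
   of the b(t_(1), t_(2)); it is meaningful for bilinear b only. *)
Section Tensor.
Variables (k : fieldType) (V W : lmodType k).

Definition tens_eq (s t : seq (V * W)) : Prop :=
  forall (U : lmodType k) (b : V -> W -> U), bilin b ->
    \sum_(x <- s) b x.1 x.2 = \sum_(x <- t) b x.1 x.2.

Definition tens_eqb : rel (seq (V * W)) := fun s t => `[< tens_eq s t >].

Lemma tens_eqb_refl : reflexive tens_eqb.
Proof. by move=> s; apply/asboolP. Qed.

Lemma tens_eqb_sym : symmetric tens_eqb.
Proof. by move=> s t; apply/asboolP/asboolP => h U b hb; rewrite h. Qed.

Lemma tens_eqb_trans : transitive tens_eqb.
Proof.
move=> t s r /asboolP h1 /asboolP h2; apply/asboolP => U b hb.
by rewrite h1 // h2.
Qed.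

Canonical tens_equiv := EquivRel tens_eqb tens_eqb_refl tens_eqb_sym tens_eqb_trans.

Definition tens : Type := {eq_quot tens_equiv}.
HB.instance Definition _ := Choice.on tens.
HB.instance Definition _ := Quotient.on tens.
HB.instance Definition _ : EqQuotient _ tens_equiv tens := EqQuotient.on tens.

Definition tsum (U : lmodType k) (b : V -> W -> U) (t : tens) : U :=
  \sum_(x <- repr t) b x.1 x.2.

Definition pure (v : V) (w : W) : tens := \pi_tens [:: (v, w)].

Lemma tens_eqP (s t : seq (V * W)) :
  tens_eq s t <-> \pi_tens s = \pi_tens t.
Proof.
split=> [h|/eqP]; first by apply/eqP; rewrite piE; apply/asboolP.
by rewrite piE => /asboolP.
Qed.

Lemma tsum_pi (U : lmodType k) (b : V -> W -> U) s :
  bilin b -> tsum b (\pi_tens s) = \sum_(x <- s) b x.1 x.2.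
Proof. move=> hb; have /tens_eqP h : \pi_tens (repr (\pi_tens s)) = \pi_tens s.
  by rewrite reprK.
exact: h. Qed.

Lemma tens_inj (t t' : tens) :
  (forall (U : lmodType k) (b : V -> W -> U), bilin b -> tsum b t = tsum b t') ->
  t = t'.
Proof. by move=> h; rewrite -[t]reprK -[t']reprK; apply/tens_eqP. Qed.

Definition tens0 : tens := \pi_tens [::].
Definition tensD (t t' : tens) : tens := \pi_tens (repr t ++ repr t').
Definition tensZ (a : k) (t : tens) : tens :=
  \pi_tens [seq (a *: x.1, x.2) | x <- repr t].

Section ops.
Variables (U : lmodType k) (b : V -> W -> U) (hb : bilin b).

Lemma tsum0_subproof : tsum b tens0 = 0.
Proof. by rewrite tsum_pi // big_nil. Qed.

Lemma tsumD_subproof t t' : tsum b (tensD t t') = tsum b t + tsum b t'.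
Proof. by rewrite tsum_pi // big_cat. Qed.

Lemma bilin0l w : b 0 w = 0.
Proof. by have := hb.1 w (-1) 0 0; rewrite /= !scaleN1r !addNr. Qed.

Lemma bilin0r v : b v 0 = 0.
Proof. by have := hb.2 v (-1) 0 0; rewrite /= !scaleN1r !addNr. Qed.

Lemma bilinZl a v w : b (a *: v) w = a *: b v w.
Proof. by have := hb.1 w a v 0; rewrite !addr0 bilin0l addr0. Qed.

Lemma bilinZr a v w : b v (a *: w) = a *: b v w.
Proof. by have := hb.2 v a w 0; rewrite !addr0 bilin0r addr0. Qed.

Lemma bilinDl v v' w : b (v + v') w = b v w + b v' w.
Proof. by have := hb.1 w 1 v v'; rewrite /= !scale1r. Qed.

Lemma bilinDr v w w' : b v (w + w') = b v w + b v w'.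
Proof. by have := hb.2 v 1 w w'; rewrite /= !scale1r. Qed.

Lemma tsumZ_subproof a t : tsum b (tensZ a t) = a *: tsum b t.
Proof.
rewrite tsum_pi // big_map scaler_sumr.
by apply: eq_bigr => x _; rewrite /= bilinZl.
Qed.
End ops.

Lemma tensDA : associative tensD.
Proof. by move=> x y z; apply: tens_inj => U b hb; rewrite !tsumD_subproof // addrA. Qed.

Lemma tensDC : commutative tensD.
Proof. by move=> x y; apply: tens_inj => U b hb; rewrite !tsumD_subproof // addrC. Qed.

Lemma tens0D : left_id tens0 tensD.
Proof.
by move=> x; apply: tens_inj => U b hb; rewrite tsumD_subproof // tsum0_subproof // add0r.
Qed.

Lemma tensND : left_inverse tens0 (tensZ (- 1)) tensD.
Proof.
move=> x; apply: tens_inj => U b hb.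
by rewrite tsumD_subproof // tsum0_subproof // tsumZ_subproof // scaleN1r addNr.
Qed.

HB.instance Definition _ := GRing.isZmodule.Build tens tensDA tensDC tens0D tensND.

Lemma tensZA a b (t : tens) : tensZ a (tensZ b t) = tensZ (a * b) t.
Proof. by apply: tens_inj => U c hc; rewrite !tsumZ_subproof // scalerA. Qed.

Lemma tens1Z : left_id 1 tensZ.
Proof. by move=> t; apply: tens_inj => U c hc; rewrite !tsumZ_subproof // scale1r. Qed.

Lemma tensZDr : right_distributive tensZ +%R.
Proof.
move=> a s t; apply: tens_inj => U c hc.
by rewrite tsumZ_subproof // !tsumD_subproof // !tsumZ_subproof // scalerDr.
Qed.

Lemma tensZDl t : {morph tensZ^~ t : a b / a + b}.
Proof.
move=> a b; apply: tens_inj => U c hc.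
by rewrite tsumD_subproof // !tsumZ_subproof // scalerDl.
Qed.

HB.instance Definition _ :=
  GRing.Zmodule_isLmodule.Build k tens tensZA tens1Z tensZDr tensZDl.

Section universal.
Variables (U : lmodType k) (b : V -> W -> U) (hb : bilin b).

Lemma tsum_linear : linear (tsum b).
Proof. by move=> a s t; rewrite tsumD_subproof // tsumZ_subproof. Qed.

Lemma tsum_pure v w : tsum b (pure v w) = b v w.
Proof. by rewrite tsum_pi // big_seq1. Qed.

Lemma tsum0 : tsum b 0 = 0. Proof. exact: tsum0_subproof. Qed.
Lemma tsumD : {morph tsum b : s t / s + t}. Proof. exact: tsumD_subproof. Qed.
Lemma tsumZ a : {morph tsum b : t / a *: t}. Proof. exact: tsumZ_subproof. Qed.

Lemma tsum_sum I (r : seq I) (F : I -> tens) :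
  tsum b (\sum_(i <- r) F i) = \sum_(i <- r) tsum b (F i).
Proof.
elim: r => [|i r IH]; first by rewrite !big_nil tsum0.
by rewrite !big_cons tsumD IH.
Qed.
End universal.

Lemma pure_bilin : bilin pure.
Proof.
split=> [w a v v'|v a w w']; apply: tens_inj => U b hb;
  by rewrite tsumD // tsumZ // !tsum_pure // (hb.1, hb.2).
Qed.

Lemma tens_pure (t : tens) : t = tsum pure t.
Proof.
apply: tens_inj => U b hb; rewrite tsum_sum //.
by apply: eq_bigr => x _; rewrite tsum_pure.
Qed.

Lemma tens_ext (U : lmodType k) (f g : tens -> U) : linear f -> linear g ->
  (forall v w, f (pure v w) = g (pure v w)) -> f =1 g.
Proof.
move=> hf hg h t; rewrite [t]tens_pure /tsum.
have lin0 (f' : tens -> U) : linear f' -> f' 0 = 0.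
  by move=> h'; have := h' (-1) 0 0; rewrite !scaleN1r !addNr.
elim: (repr t) => [|x r IH]; first by rewrite !big_nil !lin0.
rewrite !big_cons.
have := hf 1 (pure x.1 x.2) (\sum_(j <- r) pure j.1 j.2).
have := hg 1 (pure x.1 x.2) (\sum_(j <- r) pure j.1 j.2).
by rewrite !scale1r h IH => <- ->.
Qed.
End Tensor.

Lemma tsum_tsum (k : fieldType) (V W V' W' U : lmodType k) (b : V -> W -> U)
    (c : V' -> W' -> tens V W) (t : tens V' W') : bilin b ->
  tsum b (tsum c t) = tsum (fun v w => tsum b (c v w)) t.
Proof. by move=> hb; rewrite /tsum -/(tsum b _) tsum_sum. Qed.

Lemma eq_tsum (k : fieldType) (V W U : lmodType k) (b c : V -> W -> U)
    (t : tens V W) : b =2 c -> tsum b t = tsum c t.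
Proof. by move=> h; apply: eq_bigr => x _; rewrite h. Qed.

HB.instance Definition _ (k : fieldType) (V W : lmodType k) :=
  bilinear_isBilinear.Build k V W (tens V W) *:%R *:%R (@pure k V W)
    (@pure_bilin k V W).

Section TensorMaps.
Variable k : fieldType.

Definition tmap (V W V' W' : lmodType k) (f : V -> V') (g : W -> W') :
  tens V W -> tens V' W' := tsum (fun v w => pure (f v) (g w)).

Definition tswap (V W : lmodType k) : tens V W -> tens W V :=
  tsum (fun v w => pure w v).

Definition tassoc (U V W : lmodType k) :
  tens (tens U V) W -> tens U (tens V W) :=
  tsum (fun x w => tsum (fun u v => pure u (pure v w)) x).

Lemma bilin_tmap (V W V' W' : lmodType k) (f : {linear V -> V'})
  (g : {linear W -> W'}) : bilin (fun v w => pure (f v) (g w)).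
Proof. by split=> [w|v] a x y; rewrite linearP ?linearPl ?linearPr. Qed.

Lemma bilin_swap (V W : lmodType k) : bilin (fun (v : V) (w : W) => pure w v).
Proof. by split=> [w|v] a x y; rewrite ?linearPl ?linearPr. Qed.

Lemma tsum_linearb (V W U : lmodType k) (b c d : V -> W -> U) (a : k) t :
  (forall v w, b v w = a *: c v w + d v w) ->
  tsum b t = a *: tsum c t + tsum d t.
Proof.
move=> h; rewrite /tsum scaler_sumr -big_split.
by apply: eq_bigr => x _; rewrite h.
Qed.

Lemma bilin_assoc_in (U V W : lmodType k) (w : W) :
  bilin (fun (u : U) (v : V) => pure u (pure v w)).
Proof. by split=> [x|x] a y z; rewrite ?linearPl ?linearPr. Qed.

Lemma bilin_assoc (U V W : lmodType k) :
  bilin (fun (x : tens U V) (w : W) => tsum (fun u v => pure u (pure v w)) x).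
Proof.
split=> [w|x] a y z; first by rewrite tsum_linear //; apply: bilin_assoc_in.
by apply: tsum_linearb => u v; rewrite !linearPr.
Qed.
End TensorMaps.

Definition dual (k : fieldType) (V : lmodType k) : Type := {scalar V}.

Section Dual.
Variables (k : fieldType) (V : lmodType k).
Local Notation dual := (dual V).

HB.instance Definition _ := gen_eqMixin dual.
HB.instance Definition _ := gen_choiceMixin dual.

Lemma dualP (f g : dual) : f =1 g -> f = g.
Proof.
case: f => f cf; case: g => g cg /= /funext h; case: g / h cg => cg.
by case: cf => [[c1] [c2]]; case: cg => [[d1] [d2]];
  rewrite (Prop_irrelevance c1 d1) (Prop_irrelevance c2 d2).
Qed.

Definition mkdual (f : V -> k) (h : scalar f) : dual :=
  let m := GRing.isLinear.Build k V k *%R f h in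
  (HB.pack f m : {scalar V}).

Lemma dualZ_subproof (a : k) (f : dual) : scalar (fun v => a * f v).
Proof. by move=> b u v; rewrite linearP mulrDr mulrCA. Qed.

Definition dual0 : dual := (\0 : {scalar V}).
Definition dualD (f g : dual) : dual := (f \+ g : {scalar V}).
Definition dualN (f : dual) : dual := (\- f : {scalar V}).
Definition dualZ (a : k) (f : dual) : dual := mkdual (dualZ_subproof a f).

Lemma dualDA : associative dualD.
Proof. by move=> f g h; apply: dualP => v; apply: addrA. Qed.
Lemma dualDC : commutative dualD.
Proof. by move=> f g; apply: dualP => v; apply: addrC. Qed.
Lemma dual0D : left_id dual0 dualD.
Proof. by move=> f; apply: dualP => v; apply: add0r. Qed.
Lemma dualND : left_inverse dual0 dualN dualD.
Proof. by move=> f; apply: dualP => v; apply: addNr. Qed.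

HB.instance Definition _ :=
  GRing.isZmodule.Build dual dualDA dualDC dual0D dualND.

Lemma dualZA a b (f : dual) : dualZ a (dualZ b f) = dualZ (a * b) f.
Proof. by apply: dualP => v; apply: mulrA. Qed.
Lemma dual1Z : left_id 1 dualZ.
Proof. by move=> f; apply: dualP => v; apply: mul1r. Qed.
Lemma dualZDr : right_distributive dualZ +%R.
Proof. by move=> a f g; apply: dualP => v; apply: mulrDr. Qed.
Lemma dualZDl f : {morph dualZ^~ f : a b / a + b}.
Proof. by move=> a b; apply: dualP => v; apply: mulrDl. Qed.

HB.instance Definition _ :=
  GRing.Zmodule_isLmodule.Build k dual dualZA dual1Z dualZDr dualZDl.

Lemma dualDE (f g : dual) v : (f + g) v = f v + g v. Proof. by []. Qed.
Lemma dualZE a (f : dual) v : (a *: f) v = a * f v. Proof. by []. Qed.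
End Dual.

(* (f (x) id) followed by k (x) W = W, resp. (id (x) g) followed by V (x) k = V *)
Definition contractl (k : fieldType) (V W : lmodType k) (f : V -> k) :
  tens V W -> W := tsum (fun v w => f v *: w).
Definition contractr (k : fieldType) (V W : lmodType k) (g : W -> k) :
  tens V W -> V := tsum (fun v w => g w *: v).

Lemma bilin_contractl (k : fieldType) (V W : lmodType k) (f : dual V) :
  bilin (fun (v : V) (w : W) => f v *: w).
Proof.
split=> [w|v] a x y /=; first by rewrite linearP scalerDl scalerA.
by rewrite scalerDr !scalerA mulrC.
Qed.

Lemma bilin_contractr (k : fieldType) (V W : lmodType k) (g : dual W) :
  bilin (fun (v : V) (w : W) => g w *: v).
Proof.
split=> [w|v] a x y /=; first by rewrite scalerDr !scalerA mulrC.
by rewrite linearP scalerDl scalerA.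
Qed.

HB.mixin Record isCoalgebra (k : fieldType) C of GRing.Lmodule k C := {
  comul : {linear C -> tens C C};
  counit : dual C;
  comulA : forall c : C,
    tassoc (tmap comul idfun (comul c)) = tmap idfun comul (comul c);
  counitl : forall c : C, contractl counit (comul c) = c;
  counitr : forall c : C, contractr counit (comul c) = c
}.

#[short(type="coalgType")]
HB.structure Definition Coalgebra (k : fieldType) :=
  {C of GRing.Lmodule k C & isCoalgebra k C}.

(* Associative unital k-algebras, the zero algebra included: algType requires
   1 != 0, which fails for the dual of the zero coalgebra. *)
HB.mixin Record isKAlgebra (k : fieldType) A of GRing.Lmodule k A := {
  amul : A -> A -> A;
  aone : A;
  amulA : associative amul;
  amul1 : left_id aone amul;
  amulr1 : right_id aone amul;
  amul_bilin : bilin amul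
}.

#[short(type="kalgType")]
HB.structure Definition KAlgebra (k : fieldType) :=
  {A of GRing.Lmodule k A & isKAlgebra k A}.

Section Convolution.
Variables (k : fieldType) (C : coalgType k).

Lemma bilin_mul (U W : lmodType k) (f : dual U) (g : dual W) :
  bilin (fun u w => f u * g w : k^o).
Proof.
split=> [w|v] a x y /=; rewrite linearP; first by rewrite mulrDl -mulrA.
by rewrite mulrDr mulrCA.
Qed.

(* Convolution: c |-> sum of f(c_(1)) g(c_(2)) *)
Definition conv_fun (f g : dual C) (c : C) : k :=
  tsum (U := k^o) (fun a b => f a * g b) (comul c).

Lemma conv_subproof f g : scalar (conv_fun f g).
Proof. by move=> a x y; rewrite /conv_fun linearP tsum_linear //; apply: bilin_mul. Qed.

Definition conv (f g : dual C) : dual C := mkdual (conv_subproof f g).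

Lemma bilin_mull (h : dual C) (f : tens C C -> k) : scalar f ->
  bilin (fun (x : tens C C) b => f x * h b : k^o).
Proof. by move=> hf; apply: (bilin_mul (mkdual hf) h). Qed.

Lemma bilin_mulr (h : dual C) (f : tens C C -> k) : scalar f ->
  bilin (fun b (x : tens C C) => h b * f x : k^o).
Proof. by move=> hf; apply: (bilin_mul h (mkdual hf)). Qed.

Let m2 (f g : dual C) : tens C C -> k :=
  tsum (U := k^o) (fun a b => f a * g b).

Let m2_scalar f g : scalar (m2 f g).
Proof. by move=> a x y; rewrite /m2 tsum_linear //; apply: bilin_mul. Qed.

Lemma convA : associative conv.
Proof.
move=> f g h; apply: dualP => c.
transitivity (tsum (U := k^o) (fun a (y : tens C C) => f a * m2 g h y)
    (tmap idfun comul (comul c))).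
  rewrite tsum_tsum; last exact: bilin_mulr.
  rewrite -[LHS]/(tsum (U := k^o)
    (fun a b => f a * m2 g h (comul b)) (comul c)).
  apply: eq_bigr => a _; rewrite tsum_pure //; exact: bilin_mulr.
transitivity (tsum (U := k^o) (fun (y : tens C C) b => m2 f g y * h b)
    (tmap comul idfun (comul c))); last first.
  rewrite tsum_tsum; last exact: bilin_mull.
  rewrite -[RHS]/(tsum (U := k^o)
    (fun a b => m2 f g (comul a) * h b) (comul c)).
  apply: eq_bigr => a _; rewrite tsum_pure //; exact: bilin_mull.
rewrite -comulA tsum_tsum; last exact: bilin_mulr.
apply: eq_bigr => -[x b] _ /=.
rewrite tsum_tsum; last exact: bilin_mulr.
rewrite [in RHS]/m2 [in RHS]/tsum mulr_suml; apply: eq_bigr => y _.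
rewrite tsum_pure; last exact: bilin_mulr.
by rewrite /m2 tsum_pure ?mulrA //; apply: bilin_mul.
Qed.

Lemma conv1f : left_id (counit : dual C) conv.
Proof.
move=> f; apply: dualP => c; rewrite -[in RHS](counitl c).
rewrite /contractl /tsum linear_sum; apply: eq_bigr => x _.
by rewrite linearZ.
Qed.

Lemma convf1 : right_id (counit : dual C) conv.
Proof.
move=> f; apply: dualP => c; rewrite -[in RHS](counitr c).
rewrite /contractr /tsum linear_sum; apply: eq_bigr => x _.
by rewrite linearZ /= mulrC.
Qed.

Lemma conv_bilin : bilin conv.
Proof.
split=> h a f g; apply: dualP => c;
  rewrite dualDE dualZE [X in _ = X + _]mulr_sumr -[RHS]big_split /=;
  apply: eq_bigr => x _.
  by rewrite dualDE dualZE mulrDl -mulrA.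
by rewrite dualDE dualZE mulrDr mulrCA.
Qed.

HB.instance Definition _ := isKAlgebra.Build k (dual C)
  convA conv1f convf1 conv_bilin.

End Convolution.


(* The Grothendieck group: the abelian group presented by the objects, with a
   relation [B] = [A] + [C] for each short exact sequence 0 -> A -> B -> C -> 0.
   As the objects are themselves structures of the library, their type, hence
   K0, lives in a universe too large for K0 to be a zmodType; the group
   operations and laws are therefore stated directly. *)
Section K0.
Variables (Ob : Type) (ses : Ob -> Ob -> Ob -> Prop).

Inductive gexpr : Type :=
| GZero
| GClass of Ob
| GOpp of gexpr
| GAdd of gexpr & gexpr.

Inductive geq : gexpr -> gexpr -> Prop :=
| geq_refl x : geq x x
| geq_sym x y : geq x y -> geq y x
| geq_trans x y z : geq x y -> geq y z -> geq x z
| geq_opp x x' : geq x x' -> geq (GOpp x) (GOpp x')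
| geq_add x x' y y' : geq x x' -> geq y y' -> geq (GAdd x y) (GAdd x' y')
| geq_addA x y z : geq (GAdd x (GAdd y z)) (GAdd (GAdd x y) z)
| geq_addC x y : geq (GAdd x y) (GAdd y x)
| geq_add0 x : geq (GAdd GZero x) x
| geq_addN x : geq (GAdd (GOpp x) x) GZero
| geq_ses A B C : ses A B C -> geq (GClass B) (GAdd (GClass A) (GClass C)).

Definition K0 : Type := {c : gexpr -> Prop | exists x, c = geq x}.

Definition K0_pi (x : gexpr) : K0 := exist _ (geq x) (ex_intro _ x erefl).
Definition K0_repr (c : K0) : gexpr := projT1 (cid (svalP c)).

Lemma K0_reprK c : K0_pi (K0_repr c) = c.
Proof.
rewrite /K0_repr; case: cid => x /= hx; case: c hx => c hc /= hx.
by apply: eq_exist; rewrite hx.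
Qed.

Lemma K0_piP x y : K0_pi x = K0_pi y <-> geq x y.
Proof.
split=> [[h]|h]; first by rewrite h; apply: geq_refl.
apply: eq_exist; apply: funext => z; apply: propext; split=> h'.
  exact: geq_trans (geq_sym h) h'.
exact: geq_trans h h'.
Qed.

Definition K0_class (A : Ob) : K0 := K0_pi (GClass A).
Definition K0_zero : K0 := K0_pi GZero.
Definition K0_opp (c : K0) : K0 := K0_pi (GOpp (K0_repr c)).
Definition K0_add (c d : K0) : K0 := K0_pi (GAdd (K0_repr c) (K0_repr d)).

Lemma K0_repr_pi x : geq (K0_repr (K0_pi x)) x.
Proof. by apply/K0_piP; rewrite K0_reprK. Qed.

Lemma K0_opp_pi x : K0_opp (K0_pi x) = K0_pi (GOpp x).
Proof. by apply/K0_piP; apply: geq_opp; apply: K0_repr_pi. Qed.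

Lemma K0_add_pi x y : K0_add (K0_pi x) (K0_pi y) = K0_pi (GAdd x y).
Proof. by apply/K0_piP; apply: geq_add; apply: K0_repr_pi. Qed.

Lemma K0_addA : associative K0_add.
Proof.
move=> x y z; rewrite -[x]K0_reprK -[y]K0_reprK -[z]K0_reprK !K0_add_pi.
by apply/K0_piP; apply: geq_addA.
Qed.

Lemma K0_addC : commutative K0_add.
Proof. by move=> x y; apply/K0_piP; apply: geq_addC. Qed.

Lemma K0_add0 : left_id K0_zero K0_add.
Proof.
by move=> x; rewrite -[x]K0_reprK K0_add_pi; apply/K0_piP; apply: geq_add0.
Qed.

Lemma K0_addN : left_inverse K0_zero K0_opp K0_add.
Proof.
move=> x; rewrite -[x]K0_reprK K0_opp_pi K0_add_pi.
by apply/K0_piP; apply: geq_addN.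
Qed.

Lemma K0_ses A B C : ses A B C ->
  K0_class B = K0_add (K0_class A) (K0_class C).
Proof. by move=> h; rewrite K0_add_pi; apply/K0_piP; apply: geq_ses. Qed.

Lemma K0_ind (P : K0 -> Prop) :
  P K0_zero -> (forall A, P (K0_class A)) ->
  (forall x, P x -> P (K0_opp x)) ->
  (forall x y, P x -> P y -> P (K0_add x y)) ->
  forall x, P x.
Proof.
move=> h0 h1 hN hD x; rewrite -[x]K0_reprK.
elim: (K0_repr x) => [//|//|y hy|y hy z hz].
  by rewrite -K0_opp_pi; apply: hN.
by rewrite -K0_add_pi; apply: hD.
Qed.

(* Maps of K0 into an abelian group, from functions additive on short exact
   sequences. *)
Section Lift.
Variables (M : zmodType) (f : Ob -> M).

Definition ses_additive := forall A B C, ses A B C -> f B = f A + f C.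
Hypothesis f_ses : ses_additive.

Fixpoint geval (x : gexpr) : M :=
  match x with
  | GZero => 0
  | GClass A => f A
  | GOpp y => - geval y
  | GAdd y z => geval y + geval z
  end.

Lemma geval_geq x y : geq x y -> geval x = geval y.
Proof.
elim=> //=.
- by move=> {}x {}y z _ -> _ ->.
- by move=> {}x x' _ ->.
- by move=> {}x x' {}y y' _ -> _ ->.
- by move=> *; apply: addrA.
- by move=> *; apply: addrC.
- by move=> *; apply: add0r.
- by move=> *; apply: addNr.
Qed.

Definition K0_lift (_ : ses_additive) (c : K0) : M := geval (K0_repr c).

Lemma K0_lift_pi x : K0_lift f_ses (K0_pi x) = geval x.
Proof. by apply: geval_geq; apply: K0_repr_pi. Qed.

Lemma K0_lift_class A : K0_lift f_ses (K0_class A) = f A.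
Proof. exact: K0_lift_pi. Qed.
Lemma K0_lift0 : K0_lift f_ses K0_zero = 0.
Proof. exact: K0_lift_pi. Qed.
Lemma K0_liftN c : K0_lift f_ses (K0_opp c) = - K0_lift f_ses c.
Proof. exact: K0_lift_pi. Qed.
Lemma K0_liftD c d : K0_lift f_ses (K0_add c d) = K0_lift f_ses c + K0_lift f_ses d.
Proof. exact: K0_lift_pi. Qed.
End Lift.
End K0.

Section K0_map.
Variables (Ob Ob' : Type) (ses : Ob -> Ob -> Ob -> Prop).
Variables (ses' : Ob' -> Ob' -> Ob' -> Prop) (F : Ob -> Ob').

Definition ses_preserving :=
  forall A B C, ses A B C -> ses' (F A) (F B) (F C).
Hypothesis F_ses : ses_preserving.

Fixpoint gmap (x : gexpr Ob) : gexpr Ob' :=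
  match x with
  | GZero => GZero Ob'
  | GClass A => GClass (F A)
  | GOpp y => GOpp (gmap y)
  | GAdd y z => GAdd (gmap y) (gmap z)
  end.

Lemma gmap_geq x y : geq ses x y -> geq ses' (gmap x) (gmap y).
Proof.
elim=> /= *; first exact: geq_refl.
- exact: geq_sym.
- by apply: geq_trans; eassumption.
- exact: geq_opp.
- exact: geq_add.
- exact: geq_addA.
- exact: geq_addC.
- exact: geq_add0.
- exact: geq_addN.
- by apply: geq_ses; apply: F_ses.
Qed.

Definition K0_map (_ : ses_preserving) (c : K0 ses) : K0 ses' := K0_pi ses' (gmap (K0_repr c)).

Lemma K0_map_pi x : K0_map F_ses (K0_pi ses x) = K0_pi ses' (gmap x).
Proof. by apply/K0_piP; apply: gmap_geq; apply: K0_repr_pi. Qed.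

Lemma K0_map_class A : K0_map F_ses (K0_class ses A) = K0_class ses' (F A).
Proof. exact: K0_map_pi. Qed.
Lemma K0_map0 : K0_map F_ses (K0_zero ses) = K0_zero ses'.
Proof. exact: K0_map_pi. Qed.
Lemma K0_mapN c : K0_map F_ses (K0_opp c) = K0_opp (K0_map F_ses c).
Proof. by rewrite K0_map_pi /= -K0_opp_pi. Qed.
Lemma K0_mapD c d : K0_map F_ses (K0_add c d) = K0_add (K0_map F_ses c) (K0_map F_ses d).
Proof. by rewrite K0_map_pi /= -K0_add_pi. Qed.
End K0_map.

Definition short_exact (k : fieldType) (U V W : lmodType k)
    (i : {linear U -> V}) (p : {linear V -> W}) : Prop :=
  [/\ injective i, (forall v, p v = 0 <-> exists u, i u = v)
    & forall w, exists v, p v = w].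

Section Trace.
Variable k : fieldType.

Definition vcoord (V : vectType k) (n : nat) (X : n.-tuple V) (i : 'I_n) : dual V :=
  (coord X i : {scalar V}).

(* The linear map V^* (x) V -> U attached to phi, applied to the canonical
   element corresponding to id_V. *)
Definition ptrace (V : vectType k) (U : lmodType k) (phi : dual V -> V -> U) : U :=
  \sum_(i < \dim {:V}) phi (vcoord (vbasis {:V}) i) (vbasis {:V})`_i.

Section bilin_sum.
Variables (V W U : lmodType k) (b : V -> W -> U) (hb : bilin b).
Lemma bilin_suml (I : finType) (F : I -> V) w :
  b (\sum_i F i) w = \sum_i b (F i) w.
Proof.
by apply: (big_morph (b^~ w)) => [x y|]; [apply: bilinDl|apply: bilin0l].
Qed.
Lemma bilin_sumr (I : finType) (F : I -> W) v :
  b v (\sum_i F i) = \sum_i b v (F i).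
Proof. by apply: big_morph => [x y|]; [apply: bilinDr|apply: bilin0r]. Qed.
End bilin_sum.

Lemma dual_sum (V : lmodType k) (I : finType) (F : I -> dual V) v :
  (\sum_i F i) v = \sum_i F i v.
Proof. exact: (big_morph (fun f : dual V => f v)). Qed.

Lemma vbasis_sum (V : vectType k) (v : V) :
  v = \sum_(i < \dim {:V}) vcoord (vbasis {:V}) i v *: (vbasis {:V})`_i.
Proof. by rewrite {1}(coord_vbasis (memvf v)). Qed.

Lemma ptraceE (V : vectType k) (U : lmodType k) (phi : dual V -> V -> U)
    (I : finType) (xi : I -> dual V) (w : I -> V) : bilin phi ->
  (forall v, v = \sum_m xi m v *: w m) ->
  \sum_m phi (xi m) (w m) = ptrace phi.
Proof.
move=> hb h; rewrite /ptrace.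
under eq_bigr => m _ do rewrite [w m]vbasis_sum bilin_sumr //.
rewrite exchange_big /=; apply: eq_bigr => i _.
under eq_bigr => m _ do rewrite bilinZr // -bilinZl //.
rewrite -bilin_suml //; congr phi; apply: dualP => v.
rewrite dual_sum [in RHS](h v) linear_sum; apply: eq_bigr => m _.
by rewrite dualZE linearZ /= mulrC.
Qed.

Lemma dual_comp_subproof (V W : lmodType k) (f : {linear V -> W}) (xi : dual W) :
  scalar (xi \o f).
Proof. by move=> a x y /=; rewrite !linearP. Qed.
Definition dual_comp (V W : lmodType k) (f : {linear V -> W}) (xi : dual W) : dual V :=
  mkdual (dual_comp_subproof f xi).

Lemma ptrace_ses (A B C : vectType k) (U : lmodType k)
    (i : {linear A -> B}) (p : {linear B -> C})
    (fA : dual A -> A -> U) (fB : dual B -> B -> U) (fC : dual C -> C -> U) :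
  bilin fA -> bilin fB -> bilin fC -> short_exact i p ->
  (forall xi a, fB xi (i a) = fA (dual_comp i xi) a) ->
  (forall eta b, fB (dual_comp p eta) b = fC eta (p b)) ->
  ptrace fB = ptrace fA + ptrace fC.
Proof.
move=> hA hB hC [i_inj pi_ex p_surj] hi hp.
pose s : 'Hom(C, B) := ((linfun p)^-1)%VF.
have sK c : p (s c) = c.
  have := @limg_lfunVK _ _ _ (linfun p) c; rewrite lfunE /=; apply.
  by have [b <-] := p_surj c; rewrite -[p b]lfunE memv_img ?memvf.
pose r : 'Hom(B, A) := ((linfun i)^-1 \o (\1 - (s \o linfun p)))%VF.
have rK b : i (r b) = b - s (p b).
  have -> : r b = (linfun i)^-1%VF (b - s (p b)).
    by rewrite /r comp_lfunE add_lfunE opp_lfunE id_lfunE comp_lfunE lfunE.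
  have h : b - s (p b) \in limg (linfun i).
    have /pi_ex[a <-] : p (b - s (p b)) = 0 by rewrite linearB /= sK subrr.
    by rewrite -[i a]lfunE memv_img ?memvf.
  by rewrite -[RHS](limg_lfunVK h) lfunE.
have ri a : r (i a) = a.
  apply: i_inj; rewrite rK; have -> : p (i a) = 0 by apply/pi_ex; exists a.
  by rewrite linear0 subr0.
pose I := ('I_(\dim {:A}) + 'I_(\dim {:C}))%type.
pose xi (m : I) : dual B := match m with
  | inl j => dual_comp r (vcoord (vbasis {:A}) j)
  | inr j => dual_comp p (vcoord (vbasis {:C}) j) end.
pose w (m : I) : B := match m with
  | inl j => i (vbasis {:A})`_j | inr j => s (vbasis {:C})`_j end.
rewrite -(@ptraceE _ _ fB _ xi w) //; last first.
  move=> b; rewrite big_sumType /=.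
  under eq_bigr => j _ do rewrite -linearZ.
  under [X in _ + X]eq_bigr => j _ do rewrite -linearZ.
  by rewrite -!linear_sum -!vbasis_sum rK subrK.
rewrite big_sumType /=; congr (_ + _); apply: eq_bigr => j _.
  by rewrite hi; congr fA; apply: dualP => a /=; rewrite ri.
by rewrite hp sK.
Qed.
End Trace.

Definition vtrace (k : fieldType) (V : vectType k) (f : 'End(V)) : k :=
  \tr (passmx.mxof (vbasis {:V}) (vbasis {:V}) f).

Section VTrace.
Variables (k : fieldType) (V : vectType k).

Lemma vtrace_linear : scalar (@vtrace k V).
Proof. by move=> a f g; rewrite /vtrace passmx.mxof_linear linearP. Qed.

Lemma bilin_lfun (f : 'End(V)) : bilin (fun (xi : dual V) v => xi (f v) : k^o).
Proof. by split=> [v|xi] a x y //=; rewrite !linearP. Qed.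

Lemma vtraceE (f : 'End(V)) :
  vtrace f = ptrace (U := k^o) (fun xi v => xi (f v)).
Proof.
apply: eq_bigr => i _; rewrite !mxE /=.
by rewrite passmx.vecof_delta.
Qed.
End VTrace.

(* Finite dimensional left A-modules; vectType k is the type of finite
   dimensional k-spaces. *)
Record fdmod (k : fieldType) (A : kalgType k) := FdMod {
  fdmod_sort :> vectType k;
  act : {linear A -> 'End(fdmod_sort)};
  act1 : act (aone : A) = \1%VF;
  actM : forall a b : A, act (amul a b) = (act a \o act b)%VF
}.

Definition fdmod_ses (k : fieldType) (A : kalgType k) (U V W : fdmod A) : Prop :=
  exists (i : {linear U -> V}) (p : {linear V -> W}),
  [/\ short_exact i p,
      forall a u, i (act U a u) = act V a (i u)
    & forall a v, p (act V a v) = act W a (p v)].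

Definition G0k (k : fieldType) (A : kalgType k) : Type := K0 (@fdmod_ses k A).

Section Character.
Variables (k : fieldType) (A : kalgType k).

Lemma char_subproof (V : fdmod A) : scalar (fun a : A => vtrace (act V a)).
Proof. by move=> a x y; rewrite linearP vtrace_linear. Qed.

Definition char (V : fdmod A) : dual A := mkdual (char_subproof V).

Lemma char_ses : ses_additive (@fdmod_ses k A) char.
Proof.
move=> U V W [i [p [ex hi hp]]]; apply: dualP => a.
rewrite dualDE /= !vtraceE.
apply: (ptrace_ses (U := k^o) (bilin_lfun (act U a)) (bilin_lfun (act V a))
  (bilin_lfun (act W a)) ex) => [xi u|xi v] /=; first by rewrite hi.
by rewrite hp.
Qed.

Definition chi : G0k A -> dual A := K0_lift char_ses.
End Character.

(* Finite dimensional right C-comodules *)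
Record fdcomod (k : fieldType) (C : coalgType k) := FdComod {
  fdcomod_sort :> vectType k;
  coact : {linear fdcomod_sort -> tens fdcomod_sort C};
  coactA : forall v, tassoc (tmap coact idfun (coact v)) =
                     tmap idfun comul (coact v);
  coact1 : forall v, contractr counit (coact v) = v
}.

Definition fdcomod_ses (k : fieldType) (C : coalgType k)
    (U V W : fdcomod C) : Prop :=
  exists (i : {linear U -> V}) (p : {linear V -> W}),
  [/\ short_exact i p,
      forall u, tmap i idfun (coact U u) = coact V (i u)
    & forall v, tmap p idfun (coact V v) = coact W (p v)].

Definition G0c (k : fieldType) (C : coalgType k) : Type := K0 (@fdcomod_ses k C).

Section CoHH0.
Variables (k : fieldType) (C : coalgType k).

Definition coHH0_pred : pred C := fun c => comul c - tswap (comul c) == 0.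

Lemma coHH0_submod : submod_closed coHH0_pred.
Proof.
split=> [|a x y]; rewrite !unfold_in /coHH0_pred.
  by rewrite linear0 /tswap tsum0 ?subr0 //; apply: bilin_swap.
move=> /eqP hx /eqP hy; rewrite linearP /tswap tsum_linear; last exact: bilin_swap.
by rewrite opprD addrACA -scalerBr hx hy scaler0 addr0.
Qed.

HB.instance Definition _ := GRing.isSubmodClosed.Build k C coHH0_pred coHH0_submod.

Record coHH0 := CoHH0 { coHH0_val : C; coHH0_valP : coHH0_val \in coHH0_pred }.

HB.instance Definition _ := [isSub for coHH0_val].
HB.instance Definition _ := [Choice of coHH0 by <:].
HB.instance Definition _ := [SubChoice_isSubZmodule of coHH0 by <:].
HB.instance Definition _ := [SubZmodule_isSubLmodule of coHH0 by <:].
End CoHH0.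

Section Cotrace.
Variables (k : fieldType) (C : coalgType k).

(* The sum over i of e_i^*(e_i(0)) e_i(1), for a basis e *)
Definition cotrace_in (V : fdcomod C) (n : nat) (e : n.-tuple V) : C :=
  \sum_(i < n) contractl (coord e i) (coact V e`_i).

Lemma bilin_cotrace (V : fdcomod C) :
  bilin (fun (xi : dual V) v => contractl xi (coact V v)).
Proof.
split=> [v|xi] a x y /=.
  by apply: tsum_linearb => u c /=; rewrite scalerDl scalerA.
by rewrite linearP /contractl tsum_linear //; apply: bilin_contractl.
Qed.

Lemma cotrace_inE (V : fdcomod C) (n : nat) (e : n.-tuple V) :
  basis_of fullv e ->
  cotrace_in e = ptrace (fun (xi : dual V) v => contractl xi (coact V v)).
Proof.
move=> he.
apply: (ptraceE (xi := vcoord e) (w := fun i => e`_i)) => [|v].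
  exact: bilin_cotrace.
exact: coord_basis he (memvf v).
Qed.

Lemma tens_basis (V : vectType k) (W : lmodType k) (t : tens V W) :
  t = \sum_(i < \dim {:V}) pure (vbasis {:V})`_i (contractl (vcoord (vbasis {:V}) i) t).
Proof.
move: t; apply: (tens_ext (f := id)) => // [a x y|v w].
  rewrite scaler_sumr -big_split; apply: eq_bigr => i _ /=.
  by rewrite /contractl tsum_linear ?linearPr //; apply: bilin_contractl.
rewrite [in LHS](vbasis_sum v) linear_sumlz; apply: eq_bigr => i _.
rewrite /contractl tsum_pure ?linearZl_LR ?linearZr_LR //; exact: bilin_contractl.
Qed.

Lemma contractl_assoc (U V W : lmodType k) (f : dual U) (z : tens (tens U V) W) :
  contractl f (tassoc z) = tmap (contractl f) idfun z.
Proof.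
rewrite /tassoc /contractl tsum_tsum; last exact: bilin_contractl.
apply: eq_tsum => y w; rewrite tsum_tsum; last exact: bilin_contractl.
rewrite [in RHS]/tsum linear_sumlz; apply: eq_bigr => x _ /=.
by rewrite tsum_pure ?linearZl_LR //; apply: bilin_contractl.
Qed.

Lemma contractl_tmap (U V W U' : lmodType k) (f : dual U') (g : U -> U')
    (h : {linear V -> W}) (t : tens U V) :
  contractl f (tmap g h t) = h (contractl (f \o g) t).
Proof.
rewrite /contractl /tmap tsum_tsum; last exact: bilin_contractl.
rewrite [in RHS]/tsum linear_sum; apply: eq_bigr => x _.
by rewrite tsum_pure ?linearZ //; apply: bilin_contractl.
Qed.

Lemma cotrace_coHH0 (V : fdcomod C) :
  cotrace_in (vbasis {:V}) \in coHH0_pred (C := C).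
Proof.
pose e : 'I_(\dim {:V}) -> V := fun j => (vbasis {:V})`_j.
pose c l j : C := contractl (vcoord (vbasis {:V}) l) (coact V (e j)).
have Dc l j : comul (c l j) = \sum_i pure (c l i) (c i j).
  have := congr1 (contractl (vcoord (vbasis {:V}) l)) (coactA (f := V) (e j)).
  rewrite contractl_tmap => <-; rewrite contractl_assoc.
  have hp : bilin (fun v x => pure
      (contractl (vcoord (vbasis {:V}) l) (coact V v)) x : tens C C).
    split=> [x|v] a y z; rewrite ?linearPr // linearP.
    by rewrite {1}/contractl tsum_linear ?linearPl //; apply: bilin_contractl.
  rewrite {1}/tmap tsum_tsum; last first.
    split=> [x|v] a y z; rewrite ?linearPr //=.
    by rewrite {1}/contractl tsum_linear ?linearPl //; apply: bilin_contractl.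
  transitivity (tsum (fun v x => pure
      (contractl (vcoord (vbasis {:V}) l) (coact V v)) x : tens C C)
    (coact V (e j))).
    apply: eq_tsum => v x; rewrite tsum_pure //.
    split=> [x'|v'] a y z; rewrite ?linearPr //=.
    by rewrite {1}/contractl tsum_linear ?linearPl //; apply: bilin_contractl.
  rewrite [coact V (e j)]tens_basis tsum_sum //.
  by apply: eq_bigr => i _; rewrite tsum_pure.
have E : cotrace_in (vbasis {:V}) = \sum_j c j j by [].
rewrite unfold_in /coHH0_pred E linear_sum.
under eq_bigr => j _ do rewrite Dc.
rewrite subr_eq0 /tswap tsum_sum; last exact: bilin_swap.
apply/eqP; rewrite exchange_big /=; apply: eq_bigr => i _.
rewrite tsum_sum; last exact: bilin_swap.
by apply: eq_bigr => j _; rewrite tsum_pure //; apply: bilin_swap.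
Qed.

Definition cotrace (V : fdcomod C) : coHH0 C := CoHH0 (cotrace_coHH0 V).

Lemma cotrace_basis (V : fdcomod C) (n : nat) (e : n.-tuple V) :
  basis_of fullv e -> coHH0_val (cotrace V) = cotrace_in e.
Proof. by move=> he; rewrite /= !cotrace_inE // vbasisP. Qed.

Lemma cotrace_ses : ses_additive (@fdcomod_ses k C) cotrace.
Proof.
move=> U V W [i [p [ex hi hp]]]; apply: val_inj => /=.
rewrite !cotrace_inE ?vbasisP //.
apply: (ptrace_ses _ _ _ ex); try exact: bilin_cotrace.
  move=> xi u /=; rewrite -hi /contractl /tmap tsum_tsum; last exact: bilin_contractl.
  by apply: eq_tsum => v c; rewrite tsum_pure //; apply: bilin_contractl.
move=> xi u /=; rewrite -hp /contractl /tmap tsum_tsum; last exact: bilin_contractl.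
by apply: eq_tsum => v c; rewrite tsum_pure //; apply: bilin_contractl.
Qed.

Definition chic : G0c C -> coHH0 C := K0_lift cotrace_ses.
End Cotrace.

Section Comparison.
Variables (k : fieldType) (C : coalgType k).

Section Action.
Variable V : fdcomod C.

Lemma comod_act_linear (f : dual C) : linear (fun v : V => contractr f (coact V v)).
Proof.
by move=> a x y; rewrite linearP /contractr tsum_linear //; apply: bilin_contractr.
Qed.

(* f . v = sum of f(v_(1)) v_(0) *)
Definition comod_act (f : dual C) : 'End(V) :=
  linfun (fun v : V => contractr f (coact V v)).

Lemma comod_actE f v : comod_act f v = contractr f (coact V v).
Proof.
pose m := GRing.isLinear.Build k V V *:%R _ (comod_act_linear f).
pose g : {linear V -> V} := HB.pack (fun v : V => contractr f (coact V v)) m.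
exact: (lfunE g).
Qed.

Lemma comod_act_is_linear : linear comod_act.
Proof.
move=> a f g; apply/lfunP => v.
rewrite add_lfunE scale_lfunE !comod_actE.
by apply: tsum_linearb => u c; rewrite dualDE dualZE scalerDl scalerA.
Qed.

HB.instance Definition _ :=
  GRing.isLinear.Build k (dual C) 'End(V) *:%R comod_act comod_act_is_linear.

Lemma comod_act1 : comod_act (aone : dual C) = \1%VF.
Proof. by apply/lfunP => v; rewrite comod_actE id_lfunE; apply: coact1. Qed.

Lemma contractr_assoc (U W W' : lmodType k) (g : tens W W' -> k)
    (z : tens (tens U W) W') : scalar g ->
  contractr g (tassoc z) =
  tsum (fun y w' => tsum (fun u w => g (pure w w') *: u) y) z.
Proof.
move=> hg; have hb := bilin_contractr U (mkdual hg).
rewrite /tassoc /contractr tsum_tsum //; apply: eq_tsum => y w'.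
by rewrite tsum_tsum //; apply: eq_tsum => u w; rewrite tsum_pure.
Qed.

Lemma comod_actM (f g : dual C) :
  comod_act (amul f g) = (comod_act f \o comod_act g)%VF.
Proof.
apply/lfunP => v; rewrite comp_lfunE !comod_actE.
pose m2 : tens C C -> k := tsum (U := k^o) (fun a b => f a * g b).
have m2s : scalar m2 by move=> a x y; rewrite /m2 tsum_linear //; apply: bilin_mul.
have hb := bilin_contractr V (mkdual m2s).
transitivity (contractr m2 (tmap idfun comul (coact V v))).
  rewrite /contractr /tmap tsum_tsum //.
  by apply: eq_tsum => u c; rewrite tsum_pure.
rewrite -coactA contractr_assoc // /tmap.
rewrite tsum_tsum; last first.
  split=> [w|y] a x z /=.
    rewrite tsum_linear //; split=> [w'|u] b x' z' /=.
      by rewrite scalerDr !scalerA mulrC.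
    by rewrite linearPl m2s scalerDl scalerA.
  by apply: tsum_linearb => u w; rewrite linearPr m2s scalerDl scalerA.
have E : coact V (contractr g (coact V v)) =
    \sum_(x <- repr (coact V v)) g x.2 *: coact V x.1.
  by rewrite linear_sum; apply: eq_bigr => x _; rewrite linearZ.
have hf := bilin_contractr V f.
rewrite E /contractr (tsum_sum hf); apply: eq_bigr => x _.
rewrite tsum_pure; last first.
  split=> [w|y] a x' z /=.
    rewrite tsum_linear //; split=> [w'|u] b x'' z' /=.
      by rewrite scalerDr !scalerA mulrC.
    by rewrite linearPl m2s scalerDl scalerA.
  by apply: tsum_linearb => u w; rewrite linearPr m2s scalerDl scalerA.
rewrite (tsumZ hf) [in RHS]/tsum scaler_sumr; apply: eq_bigr => y _.
by rewrite /m2 tsum_pure ?scalerA 1?mulrC //; apply: bilin_mul.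
Qed.

Definition comod_mod : fdmod (dual C) := FdMod comod_act1 comod_actM.
End Action.

Lemma comod_mod_ses :
  ses_preserving (@fdcomod_ses k C) (@fdmod_ses k (dual C)) comod_mod.
Proof.
move=> U V W [i [p [ex hi hp]]]; exists i, p.
have nat_contract (X Y : fdcomod C) (h : {linear X -> Y}) (f : dual C) x :
    tmap h idfun (coact X x) = coact Y (h x) ->
    h (comod_act X f x) = comod_act Y f (h x).
  move=> E; rewrite !comod_actE -E /contractr /tmap tsum_tsum; last first.
    exact: bilin_contractr.
  rewrite [in LHS]/tsum linear_sum; apply: eq_bigr => y _.
  by rewrite tsum_pure ?linearZ //; apply: bilin_contractr.
by split=> // f v; apply: nat_contract.
Qed.

Definition comparison : G0c C -> G0k (dual C) := K0_map comod_mod_ses.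
End Comparison.

Section Evaluation.
Variables (k : fieldType) (V : lmodType k).

Lemma evdd_subproof (v : V) : scalar (fun f : dual V => f v).
Proof. by []. Qed.

Definition evdd (v : V) : dual (dual V) := mkdual (evdd_subproof v).

Lemma evdd_linear : linear evdd.
Proof. by move=> a u v; apply: dualP => f; rewrite dualDE dualZE /= linearP. Qed.

HB.instance Definition _ :=
  GRing.isLinear.Build k V (dual (dual V)) *:%R evdd evdd_linear.
End Evaluation.

(* Main.v *)
Require Import Defs.
From HB Require Import structures.
From mathcomp Require Import all_boot all_order all_algebra.

(* Both composites are additive, so it suffices to compare them on classes of
   comodules.  There, with e a basis of V, both send f in C^* to the sum of the
   scalars (e_i^* (x) f)(coact e_i). *)

Import GRing.Theory.
Local Open Scope ring_scope.

(** Both sides are [xi] (x) [f] evaluated at [t]; on a representative of [t] the terms differ only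
    by commutativity of [k]. *)
Lemma contractl_contractr (k : fieldType) (V W : lmodType k)
    (xi : dual V) (f : dual W) (t : tens V W) :
  f (contractl xi t) = xi (contractr f t).
Proof.
rewrite /contractl /contractr /tsum !linear_sum; apply: eq_bigr => x _.
by rewrite !linearZ /= mulrC.
Qed.

(** Both sides are expanded in the same basis [vbasis]: the trace of [f] is the sum of the e_i^*(f .
    e_i), and each term is [f] of a summand of the cotrace. *)
Lemma char_comod_mod (k : fieldType) (C : coalgType k) (V : fdcomod C) :
  char (comod_mod V) = evdd (coHH0_val (cotrace V)).
Proof.
apply: dualP => f; rewrite /= vtraceE /ptrace /cotrace_in linear_sum /=.
by apply: eq_bigr => i _; rewrite comod_actE -contractl_contractr.
Qed.

Theorem proposition5p10 (k : fieldType) (C : coalgType k) :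
  @evdd k C \o @coHH0_val k C \o @chic k C =1
  @chi k (dual C) \o @comparison k C.
Proof.
(* As [K0] is not a [zmodType], additivity enters as separate cases for zero, opposites and sums. *)
apply: K0_ind => [|V|x /= IH|x y /= IHx IHy] /=; rewrite /chic /chi /comparison.
- by rewrite K0_map0 !K0_lift0 /= linear0.
- by rewrite K0_map_class !K0_lift_class char_comod_mod.
- by rewrite K0_mapN !K0_liftN /= linearN /= IH.
- by rewrite K0_mapD !K0_liftD /= linearD /= IHx IHy.
Qed.
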